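(* Let $n\ge1$, and let $\Omega\subset\mathbb{R}^n$ be a bounded domain with diameter $d_\Omega$ containing the origin. Let $s\in(0,1)$ and let $A$ be a Young function satisfying $$\int^\infty \left(\frac{t}{A(t)}\right)^{\frac{s}{n-s}}\,dt=\infty,\qquad \int_0 \left(\frac{t}{A(t)}\right)^{\frac{s}{n-s}}\,dt<\infty,$$ and $i(A)<\frac ns$. Let $\omega\in L^\infty(\mathbb{R}^n)$ be a positive weight function, let $\alpha>0$, and let $$\lambda_{1,\alpha}^s = \inf\left\{\frac{1}{\alpha}\iint_{\mathbb{R}^{2n}} A(|D^s u|)\, d\nu_n \colon u\in C_c^\infty(\Omega),\ \int_\Omega \omega A(|u|)\, dx = \alpha\right\}.$$ Then there exists a positive constant $C=C(n,s,A)$ (depending only on $n,s,A$) such that $$\frac{C}{\|\omega\|_{L^\infty(\Omega)}\,M_A(d_\Omega^s)}\le\lambda_{1,\alpha}^s .$$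
   Context: A Young function is a convex, non-constant, left-continuous function $A\colon[0,\infty)\to[0,\infty]$ with $A(0)=0$. The notations $\int^\infty$ and $\int_0$ refer to divergence/convergence of the integral at infinity (on $(t_0,\infty)$) and at zero (on $(0,t_0)$), respectively, for some $t_0>0$. For a function $u$ (functions in $C_c^\infty(\Omega)$ are extended by zero to $\mathbb{R}^n$): $D^su(x,y)=\frac{u(x)-u(y)}{|x-y|^s}$, and $d\nu_n=|x-y|^{-n}\,dx\,dy$ on $\mathbb{R}^{2n}$. Matuszewska-Orlicz function and index: $M_A(t)=\sup_{\beta>0}\frac{A(\beta t)}{A(\beta)}$ and $i(A)=\lim_{t\to\infty}\frac{\log M_A(t)}{\log t}$. *)

(* Defs.v *)
From HB Require Import structures.
From mathcomp Require Import all_boot all_order all_algebra.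
From mathcomp Require Import all_classical all_reals all_analysis.

Set Implicit Arguments.
Unset Strict Implicit.
Unset Printing Implicit Defensive.

Import Order.TTheory GRing.Theory Num.Theory.
Import numFieldNormedType.Exports.

Local Open Scope classical_set_scope.
Local Open Scope ring_scope.

(* R^n is 'rV[R]_n. The topology and the derivatives are the library's; the
   library's norm on 'rV[R]_n is the max norm, so the Euclidean norm is
   defined separately. The sigma-algebra is the product of the Borel
   sigma-algebras of the coordinates. *)

Definition measure_row_display : measure_display -> measure_display.
Proof. exact. Qed.

Section measurable_row.
Context {R : realType} (n : nat).

Definition row_coord (i : 'I_n) (x : 'rV[R]_n) : R := x ord0 i.

Let row_set0 : g_sigma_preimage row_coord set0.
Proof. exact: sigma_algebra0. Qed.

Let row_setC A : g_sigma_preimage row_coord A ->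
  g_sigma_preimage row_coord (~` A).
Proof. exact: sigma_algebraC. Qed.

Let row_bigcup (F : _^nat) : (forall i, g_sigma_preimage row_coord (F i)) ->
  g_sigma_preimage row_coord (\bigcup_i (F i)).
Proof. exact: sigma_algebra_bigcup. Qed.

HB.instance Definition _ := @isMeasurable.Build
  (measure_row_display default_measure_display)
  'rV[R]_n (g_sigma_preimage row_coord) row_set0 row_setC row_bigcup.

End measurable_row.

Lemma measurable_row_coord (R : realType) n (i : 'I_n) :
  measurable_fun [set: 'rV[R]_n] (row_coord i).
Proof.
move=> _ Y mY; rewrite setTI; apply: sub_sigma_algebra => /=.
rewrite -bigcup_seq/=; exists i => /=; first by rewrite mem_index_enum.
by exists Y => //; rewrite setTI.
Qed.

Lemma measurable_fun_rowP (R : realType) n d (T : measurableType d)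
    (f : T -> 'rV[R]_n) :
  (forall i, measurable_fun [set: T] (row_coord i \o f)) ->
  measurable_fun [set: T] f.
Proof.
move=> mf.
have H : g_sigma_preimage (fun i => row_coord i \o f) `<=` measurable.
  apply: smallest_sub; first exact: sigma_algebra_measurable.
  case: n => [|n] in f mf *; first by rewrite big_ord0.
  rewrite -bigcup_mkord_ord; apply: bigcup_sub => i Ii.
  by move=> A [B mB <-]; exact: mf.
move=> _ A mA; apply: H; rewrite g_sigma_preimage_comp.
by exists A.
Qed.

Section row_cons.
Context {R : realType} (n : nat).

Definition row_cons (p : 'rV[R]_n * measurableTypeR R) : 'rV[R]_n.+1 :=
  \row_j (if unlift ord0 j is Some k then p.1 ord0 k else p.2).

Definition row_uncons (x : 'rV[R]_n.+1) : 'rV[R]_n * measurableTypeR R :=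
  (\row_j x ord0 (lift ord0 j), x ord0 ord0).

Lemma row_consK : cancel row_cons row_uncons.
Proof.
move=> [x t]; rewrite /row_uncons /row_cons mxE unlift_none/=; congr pair.
by apply/rowP => j; rewrite !mxE liftK.
Qed.

Lemma measurable_row_cons : measurable_fun setT row_cons.
Proof.
apply: measurable_fun_rowP => i.
case: (unliftP ord0 i) => [j ->|->].
- apply: (eq_measurable_fun (row_coord j \o fst)).
    by move=> p _; rewrite /row_coord/= mxE liftK.
  exact: measurableT_comp (@measurable_row_coord R n j) measurable_fst.
- apply: (eq_measurable_fun snd).
    by move=> p _; rewrite /row_coord/= mxE unlift_none.
  exact: measurable_snd.
Qed.

Lemma measurable_row_uncons : measurable_fun setT row_uncons.
Proof.
apply/measurable_fun_pairP; split.
- apply: measurable_fun_rowP => i.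
  apply: (eq_measurable_fun (row_coord (lift ord0 i))).
    by move=> x _; rewrite /row_coord/= mxE.
  exact: measurable_row_coord.
- exact: (@measurable_row_coord R n.+1 ord0).
Qed.

End row_cons.

Section lebesgue_cons.
Context {R : realType} (n : nat).
Variable mu : {sigma_finite_measure set 'rV[R]_n -> \bar R}.

Definition lebesgue_cons : set 'rV[R]_n.+1 -> \bar R :=
  pushforward (mu \x (@lebesgue_measure R))%E (@row_cons R n).

Let pm : {measure set 'rV[R]_n.+1 -> \bar R} :=
  measure_function_pushforward__canonical__measure_function_Measure
    (mu \x (@lebesgue_measure R))%E (@measurable_row_cons R n).

Let lebesgue_cons0 : lebesgue_cons set0 = 0%E.
Proof. exact: (measure0 pm). Qed.

Let lebesgue_cons_ge0 A : (0 <= lebesgue_cons A)%E.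
Proof. exact: (measure_ge0 pm). Qed.

Let lebesgue_cons_sigma_additive : semi_sigma_additive lebesgue_cons.
Proof. exact: (@measure_semi_sigma_additive _ _ _ pm). Qed.

HB.instance Definition _ := isMeasure.Build _ _ _ lebesgue_cons
  lebesgue_cons0 lebesgue_cons_ge0 lebesgue_cons_sigma_additive.

Let lebesgue_cons_sigma_finite : sigma_finite setT lebesgue_cons.
Proof.
have /sigma_finiteP[F [FT ndF Foo]] := sigma_finiteT mu.
have /sigma_finiteP[G [GT ndG Goo]] := sigma_finiteT (@lebesgue_measure R).
exists (fun i => @row_uncons R n @^-1` (F i `*` G i)).
  rewrite -preimage_bigcup (_ : \bigcup_i _ = setT) ?preimage_setT//.
  apply/seteqP; split=> // -[x t] _.
  have [i _ Fix] : (\bigcup_i F i) x by rewrite -FT.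
  have [j _ Gjt] : (\bigcup_i G i) t by rewrite -GT.
  exists (maxn i j) => //; split => /=.
  - by move: x Fix; exact/subsetPset/ndF/leq_maxl.
  - by move: t Gjt; exact/subsetPset/ndG/leq_maxr.
move=> i; have [mF Fi] := Foo i; have [mG Gi] := Goo i; split.
  rewrite -[X in measurable X]setTI; apply: measurable_row_uncons => //.
  exact: measurableX.
rewrite /lebesgue_cons /pushforward -comp_preimage.
rewrite (_ : _ \o _ = id); last by apply/funext => p /=; rewrite row_consK.
by rewrite preimage_id product_measure1E// lte_mul_pinfty// ge0_fin_numE.
Qed.

HB.instance Definition _ := Measure_isSigmaFinite.Build _ _ _ lebesgue_cons
  lebesgue_cons_sigma_finite.

End lebesgue_cons.

Section lebesgue_rV.
Context {R : realType}.

(* In dimension 0 the measure is the unit mass on the one-point space. *)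
Fixpoint lebesgue_rV (n : nat) : {sigma_finite_measure set 'rV[R]_n -> \bar R} :=
  match n with
  | 0 => [the {sigma_finite_measure set 'rV[R]_0 -> \bar R} of @dirac _ 'rV[R]_0 (0 : 'rV[R]_0) R]
  | n'.+1 => [the {sigma_finite_measure set 'rV[R]_n'.+1 -> \bar R} of
              lebesgue_cons (lebesgue_rV n')]
  end.

Lemma lebesgue_rV_box n (B : 'I_n -> set R) :
  (forall i, measurable (B i)) ->
  lebesgue_rV n [set x : 'rV[R]_n | forall i, B i (x ord0 i)] =
  (\prod_(i < n) lebesgue_measure (B i))%E.
Proof.
elim: n B => [|n IH] B mB.
  by rewrite big_ord0 /= diracE mem_set// => -[].
rewrite big_ord_recl /= /lebesgue_cons /pushforward.
have mrow m (C : 'I_m -> set R) : (forall i, measurable (C i)) ->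
    measurable [set x : 'rV[R]_m | forall i, C i (x ord0 i)].
  move=> mC; rewrite (_ : mkset _ =
      \bigcap_(i in [set: 'I_m]) (row_coord i @^-1` C i)); last first.
    by apply/seteqP; split=> x /= h; [move=> i _; exact: h|
      move=> i; exact: h].
  apply: fin_bigcap_measurable => // i _.
  by rewrite -[X in measurable X]setTI; exact: measurable_row_coord.
rewrite (_ : _ @^-1` _ =
    [set x : 'rV[R]_n | forall i, B (lift ord0 i) (x ord0 i)] `*` B ord0).
  rewrite product_measure1E; last 2 first.
  - by apply: (mrow n (fun i => B (lift ord0 i))) => i; exact: mB.
  - exact: mB.
  by rewrite muleC; congr (_ * _)%E; apply: (IH (fun i => B (lift ord0 i))).
apply/seteqP; split=> -[x t] /=.
  move=> h; split=> [i|]; last by have := h ord0; rewrite mxE unlift_none.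
  by have := h (lift ord0 i); rewrite mxE liftK.
move=> [h h0] i; rewrite mxE; case: (unliftP ord0 i) => [j ->|->] //.
Qed.

End lebesgue_rV.

Section euclidean_space.
Context {R : realType} {n : nat}.
Implicit Types (x y : 'rV[R]_n) (E Omega : set 'rV[R]_n) (u : 'rV[R]_n -> R).

Definition enorm x : R := Num.sqrt (\sum_(i < n) x ord0 i ^+ 2).

(* For unbounded E this is the default value 0 of sup. *)
Definition ediam E : R :=
  sup [set r | exists x y, [/\ E x, E y & r = enorm (x - y)]].

Definition partial (i : 'I_n) u x : R := 'D_(delta_mx ord0 i) u x.

Fixpoint Cn (k : nat) u : Prop :=
  match k with
  | 0 => continuous u
  | k'.+1 => continuous u /\ forall i : 'I_n,
      (forall x, derivable u x (delta_mx ord0 i)) /\ Cn k' (partial i u)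
  end.

Definition smooth u := forall k, Cn k u.

Definition support u : set 'rV[R]_n := closure [set x | u x != 0].

(* C_c^oo(Omega), its elements being extended by zero to R^n. *)
Definition test_function Omega u :=
  [/\ smooth u, compact (support u) & support u `<=` Omega].

Definition is_domain Omega := [/\ open Omega, connected Omega & Omega !=set0].

End euclidean_space.

Section orlicz.
Context {R : realType}.
Local Open Scope ereal_scope.

(* A function on [0, +oo) is represented by a function on R, of which only
   the values on [0, +oo) are constrained and used. *)
Definition young_function (A : R -> \bar R) : Prop :=
  [/\ A 0%R = 0,
      (forall t, (0 <= t)%R -> 0 <= A t),
      (forall l x y, (0 <= l <= 1)%R -> (0 <= x)%R -> (0 <= y)%R ->
        A (l * x + (1 - l) * y)%R <= l%:E * A x + (1 - l)%:E * A y),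
      (exists x y, [/\ (0 <= x)%R, (0 <= y)%R & A x != A y]) &
      (forall t, (0 < t)%R -> A x @[x --> t^'-] --> A t)].

(* \bar R has 0^-1 = +oo, +oo^-1 = 0 and 0 * +oo = 0; hence t / A t is +oo
   where A vanishes and 0 where A is infinite. *)
Definition matuszewska (A : R -> \bar R) (t : R) : \bar R :=
  ereal_sup [set A (b * t)%R / A b | b in [set b | (0 < b)%R]].

Definition matuszewska_index (A : R -> \bar R) : \bar R :=
  lim (lne (matuszewska A t) / (ln t)%:E @[t --> +oo%R]).

Definition young_quotient (n : nat) (s : R) (A : R -> \bar R) (t : R) : \bar R :=
  (t%:E / A t) `^ (s / (n%:R - s)).

Definition diverges_at_infinity (f : R -> \bar R) : Prop :=
  exists2 t0 : R, (0 < t0)%R &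
    \int[lebesgue_measure]_(t in `]t0, +oo[) f t = +oo.

Definition converges_at_zero (f : R -> \bar R) : Prop :=
  exists2 t0 : R, (0 < t0)%R &
    \int[lebesgue_measure]_(t in `]0%R, t0[) f t < +oo.

End orlicz.

Section eigenvalue.
Context {R : realType} {n : nat}.
Local Open Scope ereal_scope.
Implicit Types (A : R -> \bar R) (u omega : 'rV[R]_n -> R).

Definition holder_quotient (s : R) u (x y : 'rV[R]_n) : R :=
  ((u x - u y) / enorm (x - y) `^ s)%R.

(* The integral over R^2n of A(|D^s u|) against |x - y|^-n dx dy. The diagonal,
   where the inverses take the value 0, is a null set. *)
Definition energy (s : R) A u : \bar R :=
  \int[lebesgue_rV n \x lebesgue_rV n]_p
    (A `|holder_quotient s u p.1 p.2|%R * ((enorm (p.1 - p.2) ^- n)%R)%:E).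

Definition weighted_modular omega (Omega : set 'rV[R]_n) A u : \bar R :=
  \int[lebesgue_rV n]_(x in Omega) ((omega x)%:E * A `|u x|%R).

Definition lambda1 (s alpha : R) A omega (Omega : set 'rV[R]_n) : \bar R :=
  ereal_inf [set (alpha^-1)%:E * energy s A u | u in
    [set u | test_function Omega u /\
             weighted_modular omega Omega A u = alpha%:E]].

Definition Linfty_norm (Omega : set 'rV[R]_n) omega : \bar R :=
  Lnorm (lebesgue_rV n) +oo (fun x => (omega x * \1_Omega x)%R%:E).

End eigenvalue.

(* Main.v *)
(** Let d be the diameter of Omega. If u is supported in Omega and u(x) <> 0,
    then u vanishes on the cube x + ]d, 2d[^n, whose points y satisfy
    d < |x - y| <= 2nd. Keeping only these y in the double integral bounds the
    energy from below by (2n)^-n times the integral of A(|u| / (2nd)^s), and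
    A(|u|) <= M_A(d^s) M_A((2n)^s) A(|u| / (2nd)^s). The bound on the index i(A)
    only serves to make M_A finite everywhere; together with the divergence of
    the integral at infinity this forces 0 < A < +oo on ]0, +oo[. *)

Require Import Defs.
From mathcomp Require Import all_boot all_order all_algebra.
From mathcomp Require Import all_classical all_reals all_analysis.
From mathcomp Require Import measurable_realfun ess_sup_inf lra ring.
Import Order.TTheory GRing.Theory Num.Theory.
Import numFieldNormedType.Exports.
Local Open Scope classical_set_scope.
Local Open Scope ring_scope.

(** * Young functions and the Matuszewska function *)

Section young.
Context {R : realType} {A : R -> \bar R}.
Hypothesis yA : young_function A.
Local Open Scope ereal_scope.

Lemma young_ge0 {t : R} : (0 <= t)%R -> 0 <= A t.
Proof. by case: yA => _ + _ _ _; exact. Qed.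

(** Convexity on the segment from 0 to y, with A(0) = 0, gives A(x) <= (x / y) A(y), and x / y <=
    1. *)
Lemma young_homo {x y : R} : (0 <= x)%R -> (x <= y)%R -> A x <= A y.
Proof.
move=> x0 xy; have y0 := le_trans x0 xy.
have [ye0|yn0] := eqVneq y 0%R.
  by have -> : x = y by apply/le_anti; rewrite xy ye0 x0.
have yp : (0 < y)%R by rewrite lt_def yn0.
case: yA => A0 _ cvx _ _.
have l01 : (0 <= x / y <= 1)%R.
  by rewrite divr_ge0//= ler_pdivrMr// mul1r.
have := cvx (x / y)%R y 0%R l01 y0 (lexx _).
rewrite A0 mule0 adde0 mulr0 addr0 divfK// => /le_trans; apply.
rewrite -[leRHS]mul1e lee_wpmul2r ?young_ge0// lee_fin.
by case/andP: l01.
Qed.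

Lemma matuszewska_ubound (b t : R) : (0 < b)%R ->
  A (b * t)%R / A b <= matuszewska A t.
Proof. by move=> b0; apply: ereal_sup_ubound; exists b. Qed.

Lemma matuszewska_homo (t t' : R) : (0 <= t)%R -> (t <= t')%R ->
  matuszewska A t <= matuszewska A t'.
Proof.
move=> t0 tt'; apply: ge_ereal_sup => _ [b /= b0 <-].
apply: le_trans (matuszewska_ubound _ t' b0).
rewrite lee_wpmul2r ?inve_ge0 ?young_ge0 ?(ltW b0)//.
by rewrite young_homo ?mulr_ge0 ?(ltW b0)// ler_pM2l.
Qed.

(** If M_A(t) = +oo, then by monotonicity M_A = +oo on [t, +oo[, so the quotient defining the index
    is eventually +oo and no k lies above the index. *)
Lemma matuszewska_lty (k : \bar R) (t : R) :
  matuszewska_index A < k -> (0 <= t)%R -> matuszewska A t < +oo.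
Proof.
move=> ik t0; rewrite ltey; apply/eqP => Mt.
suff iy : matuszewska_index A = +oo.
  by have := lt_le_trans ik (leey k); rewrite iy ltxx.
apply/cvg_lim => //; apply: cvg_near_cst.
near=> t'.
have tt' : (t <= t')%R by near: t'; apply: nbhs_pinfty_ge; exact: num_real.
have t'1 : (1 < t')%R by near: t'; apply: nbhs_pinfty_gt; exact: num_real.
have -> : matuszewska A t' = +oo.
  by apply/eqP; rewrite -leye_eq -Mt matuszewska_homo.
by rewrite /= inver gt_eqF ?ln_gt0// gt0_mulye// lte_fin invr_gt0 ln_gt0.
Unshelve. all: by end_near. Qed.

Hypothesis Mfin : forall t : R, (0 <= t)%R -> matuszewska A t < +oo.

(** If A(b) = 0, any t with A(t) > 0 makes the quotient A(b * (t / b)) / A(b) infinite, against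
    [Mfin]. Then A vanishes on [0, +oo[, which non-constancy excludes. *)
Lemma young_gt0 (b : R) : (0 < b)%R -> 0 < A b.
Proof.
move=> b0; rewrite lt0e young_ge0 ?(ltW b0)// andbT; apply/eqP => Ab.
have Az t : (0 <= t)%R -> A t = 0.
  move=> t0; apply/eqP/negPn/negP => At.
  have := Mfin (t / b)%R (divr_ge0 t0 (ltW b0)).
  rewrite ltNge => /negP; apply.
  have := matuszewska_ubound b (t / b)%R b0.
  rewrite mulrCA divff ?gt_eqF// mulr1 Ab inve0 gt0_muley//.
  by rewrite lt0e At young_ge0.
case: yA => _ _ _ [x [y [x0 y0 +]]] _.
by rewrite !Az// eqxx.
Qed.

(** One infinite value A(b) makes A(b) / A(c) infinite unless A(c) = +oo, so A = +oo on ]0, +oo[. As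
    s < 1 <= n, the exponent s / (n - s) is positive, so the integrand t / A(t) to that power is 0
    and its integral cannot diverge. *)
Lemma young_lty {n : nat} {s : R} (b : R) : (1 <= n)%N -> (0 < s < 1)%R ->
  diverges_at_infinity (young_quotient n s A) -> (0 < b)%R -> A b < +oo.
Proof.
move=> n1 /andP[s0 s1] [t0 t0p] Iy b0; rewrite ltey; apply/eqP => Ab.
have Ay c : (0 < c)%R -> A c = +oo.
  move=> c0; apply/eqP/negPn/negP => Ac.
  have := Mfin (b / c)%R (divr_ge0 (ltW b0) (ltW c0)).
  rewrite ltNge => /negP; apply.
  have := matuszewska_ubound c (b / c)%R c0.
  rewrite mulrCA divff ?gt_eqF// mulr1 Ab gt0_mulye//.
  by rewrite inve_gt0 // ?gt_eqF ?young_gt0//.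
move: Iy; rewrite integral0_eq// => t /=; rewrite in_itv/= andbT => tt0.
rewrite /young_quotient Ay ?(lt_trans t0p)// invey mule0 poweR0r//.
rewrite gt_eqF// divr_gt0// subr_gt0 (lt_le_trans s1)//.
by rewrite ler1n.
Qed.

End young.

(** * Essential bounds and comparison of integrals *)

Lemma ae_le_Linfty d (T : measurableType d) (R : realType)
    (mu : {measure set T -> \bar R}) (f : T -> \bar R) :
  (\forall x \ae mu, `|f x| <= Lnorm mu +oo f)%E.
Proof.
rewrite unlock /=; case: ifPn => [_|]; first exact: ess_sup_ge.
(* The norm is 0 by convention when the whole space is null; the whole space then serves as the
   exceptional set. *)
rewrite -leNgt measure_le0 => /eqP m0.
by exists setT; split.
Qed.

(** The integral of a nonnegative function is a supremum over the simple functions below it, and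
    those below f are below g. This form applies directly to the integrand of [energy]. *)
Lemma ge0_le_integralT d (T : measurableType d) (R : realType)
    (mu : {measure set T -> \bar R}) (f g : T -> \bar R) :
  (forall x, 0 <= f x)%E -> (forall x, f x <= g x)%E ->
  (\int[mu]_x f x <= \int[mu]_x g x)%E.
Proof.
move=> f0 fg; have g0 x : (0 <= g x)%E by exact: le_trans (fg x).
rewrite !ge0_integralTE//; apply: ereal_sup_le => _ [h /= hf <-].
by exists h => //= x; exact: le_trans (fg x).
Qed.

(** * Measurability, Euclidean norm and diameter in R^n *)

Section euclidean.
Context {R : realType} {n : nat}.
Implicit Types x y z : 'rV[R]_n.

Lemma measurable_row_box (B : 'I_n -> set R) : (forall i, measurable (B i)) ->
  measurable [set x : 'rV[R]_n | forall i, B i (x ord0 i)].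
Proof.
move=> mB; rewrite [X in measurable X](_ : _ =
    \bigcap_(i in [set: 'I_n]) (row_coord i @^-1` B i)); last first.
  by apply/seteqP; split=> x /= h; [move=> i _; exact: h|move=> i; exact: h].
apply: fin_bigcap_measurable => // i _.
by rewrite -[X in measurable X]setTI; exact: measurable_row_coord.
Qed.

(* Rational cubes form a countable base of the topology. *)
Lemma open_measurable_row (U : set 'rV[R]_n) : open U -> measurable U.
Proof.
move=> oU.
pose box (q : 'rV[rat]_n) (k : nat) : set 'rV[R]_n :=
  [set x | forall i, ball (ratr (q ord0 i) : R) k.+1%:R^-1 (x ord0 i)].
pose F (qk : 'rV[rat]_n * nat) :=
  if `[< box qk.1 qk.2 `<=` U >] then box qk.1 qk.2 else set0.
rewrite (_ : U = \bigcup_qk F qk); last first.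
  apply/seteqP; split=> [x Ux|x [qk _]]; last first.
    by rewrite /F; case: ifPn => // /asboolP; exact.
  have /nbhs_ballP[e /= e0 xeU] : nbhs x U by exact: open_nbhs_nbhs.
  (* A radius below e / 2 suffices: x and y both lie within it of the rational centre q, hence
     within e of each other. *)
  have [k k0 ke] : exists2 k : nat, (0 < k)%N & k%:R^-1 < e / 2.
    exists (Num.trunc (e / 2)^-1).+1 => //.
    rewrite invf_plt ?posrE ?divr_gt0//.
    by rewrite truncnS_gt.
  case: k k0 ke => // k _ ke.
  have [c [cE c0 ce]] : exists c, [/\ c = k.+1%:R^-1, 0 < c & c < e / 2].
    by exists k.+1%:R^-1; split => //; rewrite invr_gt0.
  have /choice[q Hq] : forall i : 'I_n, exists q : rat,
      ratr q \in `]x ord0 i - c, x ord0 i + c[.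
    by move=> i; apply: rat_in_itvoo; lra.
  exists (\row_i q i, k) => //; rewrite /F/= /box -cE.
  rewrite asboolT.
    move=> i; rewrite mxE /ball/=; have := Hq i; rewrite in_itv/=.
    by rewrite ltr_norml => /andP[? ?]; apply/andP; split; lra.
  move=> y By; apply: xeU; split => // i j; rewrite (ord1 i).
  have := By j; have := Hq j; rewrite mxE in_itv/= /ball/= !ltr_norml.
  by move=> /andP[? ?] /andP[? ?]; apply/andP; split; lra.
apply: countable_bigcupT_measurable => [|qk]; first exact: countableP.
rewrite /F; case: ifP => // _.
apply: (measurable_row_box
  (fun i => ball (ratr (qk.1 ord0 i) : R) qk.2.+1%:R^-1)) => i.
by apply: open_measurable; apply: ball_open; rewrite invr_gt0.
Qed.

Lemma continuous_measurable_row (u : 'rV[R]_n -> R) :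
  continuous u -> measurable_fun setT u.
Proof.
move=> cu; apply: (measurability _ (RGenOpens.measurableE R)).
move=> _ [_ [a [b ->] <-]].
rewrite setTI; apply: open_measurable_row.
by move/continuousP : cu; apply; exact: interval_open.
Qed.

Lemma enorm_ge0 x : 0 <= enorm x.
Proof. exact: sqrtr_ge0. Qed.

Lemma enorm_gt (x : 'rV[R]_n) (i : 'I_n) (d : R) : 0 <= d ->
  d < `|x ord0 i| -> d < enorm x.
Proof.
move=> d0 dx; rewrite /enorm -(ger0_norm d0) -sqrtr_sqr ltr_sqrt.
  rewrite (bigD1 i)//= -[ltLHS]addr0 ltr_leD//; last first.
    by apply: sumr_ge0 => j _; rewrite sqr_ge0.
  by rewrite -(real_normK (num_real (x _ _))) ltrXn2r// (le_lt_trans _ dx).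
rewrite (bigD1 i)//= ltr_pwDl//; last by apply: sumr_ge0 => j _; rewrite sqr_ge0.
rewrite -(real_normK (num_real (x _ _))) exprn_gt0//.
exact: le_lt_trans dx.
Qed.

(** The sum of squares is at most n a^2 <= (n a)^2. The cruder factor n in place of its square root
    keeps later constants rational. *)
Lemma enorm_le (x : 'rV[R]_n) (a : R) : 0 <= a ->
  (forall i, `|x ord0 i| <= a) -> enorm x <= n%:R * a.
Proof.
move=> a0 xa; rewrite /enorm.
have na : 0 <= n%:R * a by rewrite mulr_ge0.
rewrite -[leRHS](ger0_norm na) -sqrtr_sqr ler_wsqrtr//.
apply: (@le_trans _ _ (\sum_(i < n) a ^+ 2)).
  apply: ler_sum => i _.
  by rewrite -(real_normK (num_real (x _ _))) lerXn2r// nnegrE.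
rewrite sumr_const card_ord -[leLHS]mulr_natl exprMn ler_wpM2r ?sqr_ge0//.
by rewrite -natrX ler_nat; case: (n) => // m; rewrite expnS expn1 leq_pmulr.
Qed.

Lemma le_ediam (Omega : set 'rV[R]_n) x y : bounded_set Omega ->
  Omega x -> Omega y -> enorm (x - y) <= ediam Omega.
Proof.
move=> bO Ox Oy; apply: ub_le_sup; last by exists x, y.
(* Since [ediam] is a [sup], the distances must first be shown bounded; M + 1 is a strict upper
   value as [bounded_set] demands, and its absolute value is used for nonnegativity. *)
have [M [_ /(_ (M + 1))]] := bO; rewrite ltrDl ltr01 => /(_ isT) bM.
exists (n%:R * (`|M + 1| + `|M + 1|)) => _ [a [b [Oa Ob ->]]].
have le c i : Omega c -> `|c ord0 i| <= `|M + 1|.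
  move=> /bM /= cM; apply: (le_trans _ (le_trans cM (ler_norm _))).
  rewrite [leRHS]/Num.norm/= mx_normrE.
  exact: (le_bigmax _ (fun ij : 'I_1 * 'I_n => `|c ij.1 ij.2|) (ord0, i)).
apply: enorm_le => [|i]; first by rewrite addr_ge0.
by rewrite !mxE (le_trans (ler_normB _ _))// lerD ?le.
Qed.

Lemma ediam_gt0 (Omega : set 'rV[R]_n) : (1 <= n)%N -> open Omega ->
  bounded_set Omega -> Omega 0 -> 0 < ediam Omega.
Proof.
move=> n1 oO bO O0.
have /nbhs_ballP[e /= e0 eO] : nbhs (0 : 'rV[R]_n) Omega.
  exact: open_nbhs_nbhs.
(* A nonzero point of Omega near the origin; n >= 1 provides a nonzero coordinate. *)
pose x : 'rV[R]_n := const_mx (e / 2).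
have Ox : Omega x.
  apply: eO; split => // i j; rewrite !mxE /ball/= sub0r normrN gtr0_norm; lra.
apply: lt_le_trans (le_ediam _ _ _ bO Ox O0).
apply: (enorm_gt _ (Ordinal n1)) => //.
by rewrite !mxE subr0 normr_gt0; lra.
Qed.

End euclidean.

(** * A lower bound for the energy by a scaled modular *)

Section fractional_poincare.
Context {R : realType} {A : R -> \bar R}.
Hypothesis yA : young_function A.
Hypothesis Afin : forall t : R, 0 <= t -> A t \is a fin_num.

Lemma measurable_young_comp d (T : measurableType d) (v : T -> R) :
  measurable_fun setT v -> (forall x, 0 <= v x) ->
  measurable_fun setT (fun x => A (v x)).
Proof.
(* A is constrained only on [0, +oo[; truncating its argument at 0 gives a function monotone on all
   of R, hence measurable. *)
move=> mv v0; pose B (t : R) := fine (A (Num.max 0 t)).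
have max0 (t : R) : 0 <= Num.max 0 t by rewrite le_max lexx.
have mB : measurable_fun setT B.
  apply: nondecreasing_measurable => // x y xy.
  rewrite fine_le ?Afin// (young_homo yA)// ge_max max0/=.
  by rewrite le_max xy orbT.
apply: (eq_measurable_fun (fun x => (B (v x))%:E)).
  by move=> x _; rewrite /B max_r// fineK// Afin.
apply/measurable_EFinP; exact: measurableT_comp mB mv.
Qed.

Variables (n : nat) (s d : R) (u : 'rV[R]_n -> R).
Hypotheses (n1 : (1 <= n)%N) (s0 : 0 <= s) (d0 : 0 < d) (cu : continuous u).

Lemma measurable_young_scale (c : R) : 0 <= c ->
  measurable_fun setT (fun x => A (`|u x| / c)).
Proof.
move=> c0; apply: measurable_young_comp => [|x]; last by rewrite divr_ge0.
apply: measurable_funM => //; apply: measurableT_comp => //.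
exact: continuous_measurable_row.
Qed.

(* If u x != 0 then u vanishes on the cube x + ]d, 2d[^n, all of whose points
   are at distance between d and 2nd from x. *)
Lemma le_energy :
  (forall x y, u x != 0 -> d < enorm (x - y) -> u y = 0) ->
  (\int[lebesgue_rV n]_x A (`|u x| / ((2 * n)%:R * d) `^ s)
    * ((2 * n)%:R ^- n)%:E <= energy s A u)%E.
Proof.
move=> ud; set r := (2 * n)%:R * d.
have N0 : 0 < (2 * n)%:R :> R by rewrite ltr0n muln_gt0.
have r0 : 0 < r by rewrite mulr_gt0.
have rs0 : 0 < r `^ s by rewrite powR_gt0.
pose g x := A (`|u x| / r `^ s).
have g0 x : (0 <= g x)%E by rewrite (young_ge0 yA)// divr_ge0// ltW.
have mg : measurable_fun setT g by exact: measurable_young_scale (ltW rs0).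
(* The sections of S are cubes, so [lebesgue_rV_box] computes their measure exactly. *)
pose S : set ('rV[R]_n * 'rV[R]_n) :=
  [set p : 'rV[R]_n * 'rV[R]_n | forall i : 'I_n,
    p.2 ord0 i - p.1 ord0 i \in `]d, 2 * d[].
have mS : measurable
  (S : set (('rV[R]_n : measurableType _) * ('rV[R]_n : measurableType _))).
  rewrite [S](_ : _ = \bigcap_(i in [set: 'I_n])
      ((fun p : 'rV[R]_n * 'rV[R]_n => row_coord i p.2 - row_coord i p.1)
        @^-1` `]d, 2 * d[)); last first.
    by apply/seteqP; split=> p /= h; [move=> i _; exact: h|move=> i; exact: h].
  apply: fin_bigcap_measurable => // i _.
  rewrite -[X in measurable X]setTI.
  apply: measurable_funB => //.
  - exact: measurableT_comp (@measurable_row_coord R n i) measurable_snd.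
  - exact: measurableT_comp (@measurable_row_coord R n i) measurable_fst.
(* G is the minorant of the energy integrand: on S, |x - y| is replaced by its upper bound r. *)
pose G (p : 'rV[R]_n * 'rV[R]_n) := (g p.1 * (r ^- n)%:E * (\1_S p)%:E)%E.
have rn0 : 0 <= r ^- n by rewrite invr_ge0 exprn_ge0// ltW.
have G0 p : (0 <= G p)%E by rewrite !mule_ge0// lee_fin.
have mG : measurable_fun setT G.
  apply: emeasurable_funM; last by apply/measurable_EFinP.
  apply: emeasurable_funM => //.
  exact: measurableT_comp mg measurable_fst.
have GE : (\int[lebesgue_rV n \x lebesgue_rV n]_p G p =
    \int[lebesgue_rV n]_x g x * ((2 * n)%:R ^- n)%:E)%E.
  (* The inner integral over y is the volume d^n of the cube, and d^n / r^n = (2n)^-n. *)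
  rewrite fubini_tonelli1// -ge0_integralZr//.
  apply: eq_integral => x _; rewrite /fubini_F/= /G/=.
  have S1 y : \1_S (x, y) = \1_(xsection S x) y :> R.
    by rewrite !indicE mem_xsection.
  under eq_integral do rewrite S1.
  have mSx : measurable (xsection S x) by exact: measurable_xsection.
  rewrite ge0_integralZl//; last 2 first.
  - by apply/measurable_EFinP; exact: measurable_indic.
  - by rewrite mule_ge0// lee_fin.
  rewrite integral_indic//.
  pose B (i : 'I_n) : set R := `]x ord0 i + d, x ord0 i + 2 * d[%classic.
  rewrite setIT (_ : xsection S x = [set y | forall i, B i (y ord0 i)]);
    last first.
    apply/seteqP; split => y; rewrite /xsection/= inE /S/= => h i;
      by have := h i; rewrite /B/= !in_itv/= => /andP[? ?];
      apply/andP; split; lra.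
  rewrite [X in (_ * X)%E](_ : _ = (\prod_(i < n) lebesgue_measure (B i))%E);
    last by apply: lebesgue_rV_box => i; exact: measurable_itv.
  have d2 : d < 2 * d by rewrite ltr_pMl// ltr1n.
  have BE i : lebesgue_measure (B i) = d%:E.
    rewrite /B lebesgue_measure_itv/= lte_fin ltrD2l d2.
    by rewrite -EFinB; congr (_%:E); ring.
  under eq_bigr do rewrite BE.
  rewrite prodEFin prodr_const card_ord -muleA -EFinM; congr (_ * _%:E)%E.
  by rewrite /r exprMn invfM -mulrA mulVf ?mulr1// expf_neq0// gt_eqF.
rewrite -GE /energy; apply: ge0_le_integralT => [|[x y]]; first exact: G0.
rewrite /G/=.
have F0 : (0 <= A `|holder_quotient s u x y|%R * (enorm (x - y) ^- n)%:E)%E.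
  by rewrite mule_ge0 ?(young_ge0 yA)// lee_fin invr_ge0 exprn_ge0// enorm_ge0.
have [Sxy|nSxy] := pselect (S (x, y)); last first.
  by rewrite indicE memNset// mule0.
rewrite indicE mem_set// mule1.
have [ux0|ux] := eqVneq (u x) 0.
  by rewrite /g ux0 normr0 mul0r; case: yA => -> _ _ _ _; rewrite mul0e.
have dxy : d < enorm (x - y).
  apply: (enorm_gt _ (Ordinal n1)); first exact: ltW.
  have := Sxy (Ordinal n1); rewrite /= !mxE in_itv/= distrC => /andP[? _].
  exact: lt_le_trans (ler_norm _).
(* Each coordinate of x - y is at most 2d in absolute value, whence r = n * 2d. *)
have xyr : enorm (x - y) <= r.
  rewrite /r mulnC natrM -mulrA; have d2 : 0 <= 2 * d by rewrite mulr_ge0 ?ltW.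
  apply: enorm_le => [//|i].
  have := Sxy i; rewrite /= !mxE in_itv/= distrC ler_norml => /andP[? ?].
  by apply/andP; split; lra.
have e0 : 0 < enorm (x - y) by exact: lt_trans dxy.
(* As u(y) = 0, the quotient is |u(x)| / |x - y|^s >= |u(x)| / r^s; the kernel is likewise at least
   r^-n. *)
rewrite /holder_quotient (ud x y ux dxy) subr0 normrM normfV.
rewrite (ger0_norm (powR_ge0 _ _)); apply: lee_pmul => //.
- apply: (young_homo yA); first by rewrite divr_ge0// ltW.
  by rewrite ler_wpM2l// lef_pV2 ?posrE ?powR_gt0// ge0_ler_powR// nnegrE ltW.
- by rewrite lee_fin lef_pV2 ?posrE ?exprn_gt0// lerXn2r// nnegrE ltW.
Qed.

End fractional_poincare.

(** * The weighted modular and the eigenvalue bound *)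

Lemma weighted_modular_le {R : realType} {n : nat} {A : R -> \bar R}
    {omega u v : 'rV[R]_n -> R} {Omega : set 'rV[R]_n} {N k : R} :
  (forall t : R, 0 <= t -> (0 <= A t)%E) ->
  measurable Omega -> measurable_fun setT omega ->
  measurable_fun setT (fun x => A `|u x|) ->
  measurable_fun setT (fun x => A `|v x|) ->
  Linfty_norm Omega omega = N%:E -> 0 <= k ->
  (forall x, A `|u x|%R <= k%:E * A `|v x|%R)%E ->
  (weighted_modular omega Omega A u <=
    (N * k)%:E * \int[lebesgue_rV n]_x A `|v x|%R)%E.
Proof.
move=> A0 mO mo mu mv NE k0 uv.
have N0 : 0 <= N by rewrite -lee_fin -NE Lnorm_ge0.
have mo' : measurable_fun setT (EFin \o omega) by exact/measurable_EFinP.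
(* Absolute values let the essential bound |omega| <= N act pointwise on Omega; the domain is then
   enlarged to R^n. *)
rewrite /weighted_modular (le_trans (lee_abs _))//.
apply: le_trans (le_abse_integral _ mO _) _.
  by apply: measurable_funTS; exact: emeasurable_funM.
rewrite -ge0_integralZl//; last 2 first.
- by move=> x _; exact: A0.
- by rewrite lee_fin mulr_ge0.
apply: (@le_trans _ _ (\int[lebesgue_rV n]_(x in Omega)
    ((N * k)%:E * A `|v x|%R))%E); last first.
  apply: ge0_subset_integral => //.
  - by apply: emeasurable_funM.
  - by move=> x _; rewrite mule_ge0 ?A0// lee_fin mulr_ge0.
apply: ae_ge0_le_integral => //.
- apply: measurableT_comp => //.
  by apply: measurable_funTS; exact: emeasurable_funM.
- by move=> x _; rewrite mule_ge0 ?A0// lee_fin mulr_ge0.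
- by apply: measurable_funTS; exact: emeasurable_funM.
have := ae_le_Linfty _ _ _ (lebesgue_rV n) (fun x => (omega x * \1_Omega x)%:E).
rewrite -/(Linfty_norm Omega omega) NE; apply: filterS => x + Ox.
rewrite indicE mem_set// mulr1 /= lee_fin => oN.
rewrite abseM EFinM -muleA lee_pmul//.
by rewrite gee0_abs ?A0.
Qed.

Theorem theorem1p2 (R : realType) (n : nat) (s : R) (A : R -> \bar R) :
  (1 <= n)%N ->
  0 < s < 1 ->
  young_function A ->
  diverges_at_infinity (young_quotient n s A) ->
  converges_at_zero (young_quotient n s A) ->
  (matuszewska_index A < (n%:R / s)%:E)%E ->
  exists2 C : R, 0 < C &
    forall (Omega : set 'rV[R]_n) (omega : 'rV[R]_n -> R) (alpha : R),
      is_domain Omega ->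
      bounded_set Omega ->
      Omega 0 ->
      omega \in Lfun (lebesgue_rV n) +oo%E ->
      {ae lebesgue_rV n, forall x, 0 < omega x} ->
      0 < alpha ->
      (C%:E / (Linfty_norm Omega omega * matuszewska A (ediam Omega `^ s))
        <= lambda1 s alpha A omega Omega)%E.
Proof.
move=> n1 s01 yA divA _ iA.
have Mfin t : 0 <= t -> (matuszewska A t < +oo)%E.
  by move=> t0; exact: (matuszewska_lty yA _ _ iA t0).
have Ap t : 0 < t -> (0 < A t)%E by exact: (young_gt0 yA Mfin t).
have Afin t : 0 <= t -> A t \is a fin_num.
  rewrite le_eqVlt => /predU1P[<-|t0]; first by case: yA => ->.
  rewrite ge0_fin_numE ?(young_ge0 yA) ?(ltW t0)//.
  exact: (young_lty yA Mfin t n1 s01 divA t0).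
have Mr t : 0 < t -> exists2 m : R, 0 < m & matuszewska A t = m%:E.
  move=> t0; have Mp : (0 < matuszewska A t)%E.
    (* The choice b = 1 already gives the positive value A(t) / A(1). *)
    apply: lt_le_trans (matuszewska_ubound 1 t ltr01); rewrite mul1r.
    have A1y : A 1 != +oo%E by apply/eqP => e; have := Afin 1 ler01; rewrite e.
    by rewrite mule_gt0 ?Ap// inve_gt0 ?A1y ?Ap// gt_eqF ?Ap.
  exists (fine (matuszewska A t)); last first.
    by rewrite fineK// ge0_fin_numE ?Mfin// ltW.
  by rewrite fine_gt0// Mp Mfin ?ltW.
have AM (b t m : R) : 0 <= b -> matuszewska A t = m%:E ->
    (A (b * t)%R <= m%:E * A b)%E.
  rewrite le_eqVlt => /predU1P[<-|b0] tm.
    by rewrite mul0r; case: yA => -> _ _ _ _; rewrite mule0.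
  have := matuszewska_ubound (A := A) b t b0; rewrite tm.
  have := Ap b b0; rewrite -(fineK (Afin b (ltW b0))) lte_fin => a0.
  by rewrite inver gt_eqF// lee_pdivrMr.
have [s0 s1] := andP s01.
pose N : R := (2 * n)%:R.
have N0 : 0 < N by rewrite ltr0n muln_gt0.
have [K K0 KE] := Mr (N `^ s) (powR_gt0 s N0).
have Nn0 : 0 < N ^- n by rewrite invr_gt0 exprn_gt0.
(* With N = 2n and K = M_A((2n)^s), the constant is fixed before Omega, omega and alpha. The factor
   N^-n comes from [le_energy], and K from removing the factor N^s in the argument of A. *)
exists (N ^- n / K); first by rewrite divr_gt0.
move=> Omega omega alpha [oO _ _] bO O0 oL _ a0.
set d := ediam Omega.
have d0 : 0 < d by exact: ediam_gt0.
have [m m0 mE] := Mr (d `^ s) (powR_gt0 s d0).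
have mo : measurable_fun setT omega.
  by move: oL; rewrite inE => /andP[/[!inE]].
apply: le_ereal_inf_tmp => _ [u [[smu _ su] ua] <-].
have cu : continuous u by exact: smu 0.
have E0 : (0 <= energy s A u)%E.
  apply: integral_ge0 => p _; rewrite mule_ge0 ?(young_ge0 yA)// lee_fin.
  by rewrite invr_ge0 exprn_ge0// enorm_ge0.
have L0 : (0 <= Linfty_norm Omega omega)%E by exact: Lnorm_ge0.
rewrite mE.
case LE : (Linfty_norm Omega omega) L0 => [nu| |] //; last first.
  (* For an infinite norm the left side is C / +oo = 0. *)
  rewrite gt0_mulye ?lte_fin// invey mule0 mule_ge0// lee_fin invr_ge0.
  by rewrite ltW.
rewrite lee_fin => nu0.
have uO x : u x != 0 -> Omega x.
  by move=> ux; apply: su; exact: subset_closure.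
have ud x y : u x != 0 -> d < enorm (x - y) -> u y = 0.
  move=> ux; apply: contraTeq => uy.
  by rewrite -leNgt le_ediam//; exact: uO.
have Nd0 : 0 < (N * d) `^ s by rewrite powR_gt0// mulr_gt0.
(* The factors d^s and N^s are removed one after the other, so that the domain enters only through m
   = M_A(d^s). *)
have young_scale x :
    (A `|u x|%R <= (m * K)%:E * A `|u x / (N * d) `^ s|%R)%E.
  set v := `|u x / (N * d) `^ s|.
  have -> : `|u x| = v * N `^ s * d `^ s.
    rewrite /v normrM normfV (gtr0_norm Nd0) powRM ?(ltW N0) ?(ltW d0)//.
    by rewrite -!mulrA mulVf ?mulr1// mulf_neq0// gt_eqF// powR_gt0.
  apply: (le_trans (AM _ _ _ _ mE)).
    by rewrite mulr_ge0 ?normr_ge0// powR_ge0.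
  rewrite EFinM -muleA; apply: lee_wpmul2l; first by rewrite lee_fin ltW.
  exact: AM (normr_ge0 _) KE.
have AvE x : A `|u x / (N * d) `^ s| = A (`|u x| / (N * d) `^ s).
  by rewrite normrM normfV (gtr0_norm Nd0).
have mAu : measurable_fun setT (fun x => A `|u x|).
  apply: eq_measurable_fun (measurable_young_scale yA Afin _ _ cu 1 ler01).
  by move=> x _; rewrite divr1.
have mAv : measurable_fun setT (fun x => A `|u x / (N * d) `^ s|).
  apply: eq_measurable_fun
    (measurable_young_scale yA Afin _ _ cu _ (ltW Nd0)) => x _.
  by rewrite AvE.
have := weighted_modular_le (@young_ge0 _ _ yA)
  (open_measurable_row _ oO) mo mAu mAv LE (ltW (mulr_gt0 m0 K0)) young_scale.
rewrite ua; under eq_integral do rewrite AvE.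
have := le_energy yA Afin n s d u n1 (ltW s0) d0 cu ud.
rewrite -/N; set I := (\int[_]_x _)%E => IE uI.
(* A zero norm would make the modular vanish, while it equals alpha > 0. *)
have nup : 0 < nu.
  rewrite lt_def nu0 andbT; apply/eqP => nuz; move: uI.
  by rewrite nuz mul0r mul0e lee_fin leNgt a0.
have p0 : 0 < nu * (m * K) by rewrite !mulr_gt0.
(* It remains to chain alpha / (nu m K) <= I with N^-n I <= energy and divide by alpha. *)
move: uI; rewrite -lee_pdivrMl// => uI.
rewrite lee_pdivlMl// -EFinM inver gt_eqF ?mulr_gt0// -!EFinM.
apply: le_trans IE.
rewrite (_ : alpha * _ = (nu * (m * K))^-1 * alpha * N ^- n).
  by rewrite EFinM EFinM lee_wpmul2r// lee_fin ltW.
by rewrite !invfM; ring.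
Qed.
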